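(* Let $ABC$ be a (non-degenerate) triangle in the Euclidean plane, and let $D$, $E$, and $F$ be arbitrary points on sides $BC$, $AC$, and $AB$, respectively, different from the vertices $A,B,C$. Denote $BE\cap CF=G_1$, $AD\cap CF=G_2$, and $AD\cap BE=G_3$. Let the areas of $\triangle AEF$, $\triangle BFD$, $\triangle CDE$, $\triangle DEF$, and $\triangle G_1G_2G_3$ be $p$, $q$, $r$, $x$, and $y$, respectively. Then $$x^3+(p+q+r)x^2-4pqr\ge x^2y.$$
   Context: $XY\cap ZW$ denotes the intersection point of the lines $XY$ and $ZW$. Areas are unsigned; a triangle whose vertices coincide or are collinear has area $0$. *)

(* Defs.v *)
From HB Require Import structures.
From mathcomp Require Import all_boot all_order all_algebra.
From mathcomp Require Import boolp classical_sets reals.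
Set Implicit Arguments.
Unset Strict Implicit.
Unset Printing Implicit Defensive.
Import Order.TTheory GRing.Theory Num.Theory.
Local Open Scope classical_set_scope.
Local Open Scope ring_scope.

(* A genuine line only when [X != Y]; it is [[set X]] when [X = Y]. *)
Definition line (R : realType) (X Y : 'rV[R]_2) : set 'rV[R]_2 :=
  [set P | exists t : R, P = (1 - t) *: X + t *: Y].

Definition segment (R : realType) (X Y : 'rV[R]_2) : set 'rV[R]_2 :=
  [set P | exists2 t : R, 0 <= t <= 1 & P = (1 - t) *: X + t *: Y].

Definition collinear (R : realType) (X Y Z : 'rV[R]_2) : Prop :=
  exists U V : 'rV[R]_2, U != V /\ [/\ line U V X, line U V Y & line U V Z].

(* Unsigned area: half the absolute value of the determinant with rows
   [Y - X] and [Z - X]. *)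
Definition triangle_area (R : realType) (X Y Z : 'rV[R]_2) : R :=
  `|(Y 0 0 - X 0 0) * (Z 0 1 - X 0 1)
    - (Y 0 1 - X 0 1) * (Z 0 0 - X 0 0)| / 2.

(* Main.v *)
(* In barycentric coordinates with area ABC normalised to 1, put
   D = (1-d)B + dC, E = (1-e)C + eA, F = (1-f)A + fB.  Then p = f(1-e),
   q = d(1-f), r = e(1-d), and with u = def, v = (1-d)(1-e)(1-f) one has
   x = 1-p-q-r = u+v and pqr = uv, while Routh's theorem gives
   y = (u-v)^2 / ((1-p)(1-q)(1-r)).  The claim becomes
   (u-v)^2 >= x^2 (u-v)^2 / ((1-p)(1-q)(1-r)), which follows from
   x^2 <= x = 1-p-q-r <= (1-p)(1-q)(1-r). *)
Require Import Defs.
From HB Require Import structures.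
From mathcomp Require Import all_boot all_order all_algebra.
From mathcomp Require Import boolp classical_sets reals.
From mathcomp Require Import ring lra.
Set Implicit Arguments.
Unset Strict Implicit.
Unset Printing Implicit Defensive.
Import Order.TTheory GRing.Theory Num.Theory.
Local Open Scope classical_set_scope.
Local Open Scope ring_scope.

Lemma row2P (R : realType) (X Y : 'rV[R]_2) :
  X 0 0 = Y 0 0 -> X 0 1 = Y 0 1 -> X = Y.
Proof.
move=> h0 h1; apply/rowP => i.
case: i => [[|[|]] // hi].
  by rewrite (_ : Ordinal hi = 0) //; apply: val_inj.
by rewrite (_ : Ordinal hi = 1) //; apply: val_inj.
Qed.

(** Twice the signed area. Without the absolute value of [triangle_area], area relations become
    polynomial identities. *)
Definition orient (R : realType) (X Y Z : 'rV[R]_2) : R :=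
  (Y 0 0 - X 0 0) * (Z 0 1 - X 0 1) - (Y 0 1 - X 0 1) * (Z 0 0 - X 0 0).

Lemma orient_cycle (R : realType) (X Y Z : 'rV[R]_2) :
  orient Y Z X = orient X Y Z.
Proof. rewrite /orient; ring. Qed.

Lemma orient_eq0_collinear (R : realType) (A B C : 'rV[R]_2) :
  A != B -> orient A B C = 0 -> collinear A B C.
Proof.
move=> neqAB; rewrite /orient => h.
exists A, B; split=> //; split.
- by exists 0; rewrite subr0 scale1r scale0r addr0.
- by exists 1; rewrite subrr scale1r scale0r add0r.
(* The parameter of [C] on the line is a quotient by a coordinate of [B - A], so the case split
   picks a nonzero one. *)
have [h0|h0] := eqVneq (B 0 0 - A 0 0) 0.
  have h1 : B 0 1 - A 0 1 != 0.
    apply: contra_neq neqAB => h1.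
    by apply: row2P; apply/esym/eqP; rewrite -subr_eq0 ?h0 ?h1.
  exists ((C 0 1 - A 0 1) / (B 0 1 - A 0 1)).
  have h2 : C 0 0 - A 0 0 = 0.
    by apply: (mulfI h1); rewrite mulr0; move: h; rewrite h0; lra.
  apply: row2P; rewrite !mxE; last by field.
  have -> : B 0 0 = A 0 0 by lra.
  by lra.
exists ((C 0 0 - A 0 0) / (B 0 0 - A 0 0)).
apply: row2P; rewrite !mxE; first by field.
apply: (mulfI h0).
rewrite [RHS](_ : _ = (B 0 0 - A 0 0) * A 0 1
  + (C 0 0 - A 0 0) * (B 0 1 - A 0 1)); first by lra.
by field.
Qed.

(** The factor is the determinant of the matrix of barycentric coordinates. Eliminating [a1], [a2],
    [a3] through the normalisations leaves a polynomial identity. *)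
Lemma orient_bary (R : realType) (A B C : 'rV[R]_2)
    (a1 b1 c1 a2 b2 c2 a3 b3 c3 : R) :
  a1 + b1 + c1 = 1 -> a2 + b2 + c2 = 1 -> a3 + b3 + c3 = 1 ->
  orient (a1 *: A + b1 *: B + c1 *: C) (a2 *: A + b2 *: B + c2 *: C)
    (a3 *: A + b3 *: B + c3 *: C)
  = (a1 * (b2 * c3 - b3 * c2) - b1 * (a2 * c3 - a3 * c2)
     + c1 * (a2 * b3 - a3 * b2)) * orient A B C.
Proof.
move=> h1 h2 h3; rewrite /orient !mxE.
have -> : a1 = 1 - b1 - c1 by lra.
have -> : a2 = 1 - b2 - c2 by lra.
have -> : a3 = 1 - b3 - c3 by lra.
ring.
Qed.

(** Barycentric coordinates are unique in a non-degenerate triangle, so the two expressions of [G],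
    on [AD] and on [BE], can be compared coordinatewise. The form is cyclic, so one lemma serves all
    three intersections. *)
Lemma cevian_meet (R : realType) (A B C D E G : 'rV[R]_2) (d e : R) :
  orient A B C != 0 ->
  D = (1 - d) *: B + d *: C -> E = (1 - e) *: C + e *: A ->
  1 - e * (1 - d) != 0 ->
  line A D G -> line B E G ->
  G = (e * d / (1 - e * (1 - d))) *: A
      + ((1 - d) * (1 - e) / (1 - e * (1 - d))) *: B
      + (d * (1 - e) / (1 - e * (1 - d))) *: C.
Proof.
move=> K0 -> -> den0 [t ->] [s hs].
(* Up to the factor [orient A B C], [orient A B] extracts the [C]-coordinate; below, [orient C A]
   extracts the [B]-coordinate. *)
have hc : t * d = s * (1 - e).
  apply: (mulIf K0); have := congr1 (orient A B) hs.
  by rewrite /orient !mxE; lra.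
have hb : t * (1 - d) = 1 - s.
  apply: (mulIf K0); have := congr1 (orient C A) hs.
  by rewrite /orient !mxE; lra.
(* Adding [hc] and [hb] gives [t = 1 - s * e]; with [hb] this eliminates [s]. *)
have ht : t = (1 - e) / (1 - e * (1 - d)).
  apply: (mulIf den0); rewrite divfK //.
  rewrite [LHS](_ : _ = t - e * (t * (1 - d))); last by ring.
  by rewrite hb; lra.
rewrite ht.
by apply: row2P; rewrite !mxE; field.
Qed.

(** If the endpoints coincided, [P] would equal both; applied to [F], this later supplies
    [A != B]. *)
Lemma segment_ratio (R : realType) (X Y P : 'rV[R]_2) :
  segment X Y P -> P != X -> P != Y ->
  exists t : R, [/\ 0 < t, t < 1, X != Y & P = (1 - t) *: X + t *: Y].
Proof.
move=> [t /andP[t0 t1] ->] nX nY; exists t; split=> //.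
- rewrite lt_neqAle t0 andbT; apply: contra_neq nX => <-.
  by rewrite subr0 scale1r scale0r addr0.
- rewrite lt_neqAle t1 andbT; apply: contra_neq nY => ->.
  by rewrite subrr scale1r scale0r add0r.
- apply: contra_neq nX => ->.
  by rewrite -scalerDl subrK scale1r.
Qed.

(** The determinant is passed as a separate [k], so that each use can name its closed form and check
    it by computation. *)
Lemma triangle_area_bary (R : realType) (A B C P Q S : 'rV[R]_2)
    (a1 b1 c1 a2 b2 c2 a3 b3 c3 k : R) :
  P = a1 *: A + b1 *: B + c1 *: C -> Q = a2 *: A + b2 *: B + c2 *: C ->
  S = a3 *: A + b3 *: B + c3 *: C ->
  a1 + b1 + c1 = 1 -> a2 + b2 + c2 = 1 -> a3 + b3 + c3 = 1 ->
  a1 * (b2 * c3 - b3 * c2) - b1 * (a2 * c3 - a3 * c2)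
    + c1 * (a2 * b3 - a3 * b2) = k ->
  triangle_area P Q S = `|k| * triangle_area A B C.
Proof.
move=> -> -> -> h1 h2 h3 <-.
rewrite /triangle_area mulrA -normrM; congr (`|_| / 2); exact: orient_bary.
Qed.

Lemma routh_area (R : realType) (A B C D E F G1 G2 G3 : 'rV[R]_2) (d e f : R) :
  orient A B C != 0 ->
  0 < d < 1 -> 0 < e < 1 -> 0 < f < 1 ->
  D = (1 - d) *: B + d *: C -> E = (1 - e) *: C + e *: A ->
  F = (1 - f) *: A + f *: B ->
  (line B E `&` line C F) G1 -> (line A D `&` line C F) G2 ->
  (line A D `&` line B E) G3 ->
  triangle_area G1 G2 G3 =
    (d * e * f - (1 - d) * (1 - e) * (1 - f)) ^+ 2
    / ((1 - f * (1 - e)) * (1 - d * (1 - f)) * (1 - e * (1 - d)))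
    * triangle_area A B C.
Proof.
move=> K0 /andP[d0 d1] /andP[e0 e1] /andP[f0 f1] hD hE hF.
move=> [g1B g1C] [g2A g2C] [g3A g3B].
have den_gt0 (s t : R) : 0 < s -> s < 1 -> 0 < t -> 0 < 1 - s * (1 - t).
  by move=> *; nra.
have n1 : 0 < 1 - f * (1 - e) by exact: den_gt0.
have n2 : 0 < 1 - d * (1 - f) by exact: den_gt0.
have n3 : 0 < 1 - e * (1 - d) by exact: den_gt0.
have K1 : orient B C A != 0 by rewrite orient_cycle.
have K2 : orient C A B != 0 by rewrite orient_cycle.
have m1 : 1 - f * (1 - e) != 0 by rewrite gt_eqF.
have m2 : 1 - d * (1 - f) != 0 by rewrite gt_eqF.
have m3 : 1 - e * (1 - d) != 0 by rewrite gt_eqF.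
(* The cyclic relabellings give coordinates in the orders [B, C, A] and [C, A, B]; the rewrites
   restore [A, B, C]. *)
have hG1 := cevian_meet K1 hE hF m1 g1B g1C.
rewrite addrC addrA in hG1.
have hG2 := cevian_meet K2 hF hD m2 g2C g2A.
rewrite -addrA addrC in hG2.
have hG3 := cevian_meet K0 hD hE m3 g3A g3B.
set k := _ / _.
have k_ge0 : 0 <= k by rewrite divr_ge0 ?sqr_ge0 // ltW // !mulr_gt0.
rewrite (triangle_area_bary (k := k) hG1 hG2 hG3) ?ger0_norm //.
- by field.
- by field.
- by field.
- by rewrite /k; field; rewrite m1 m2 m3.
Qed.

Lemma normalized_area_ineq (R : realFieldType) (d e f : R) :
  0 < d < 1 -> 0 < e < 1 -> 0 < f < 1 ->
  (d * e * f + (1 - d) * (1 - e) * (1 - f)) ^+ 2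
  * ((d * e * f - (1 - d) * (1 - e) * (1 - f)) ^+ 2
     / ((1 - f * (1 - e)) * (1 - d * (1 - f)) * (1 - e * (1 - d))))
  <= (d * e * f - (1 - d) * (1 - e) * (1 - f)) ^+ 2.
Proof.
move=> /andP[d0 d1] /andP[e0 e1] /andP[f0 f1].
set u := d * e * f; set v := (1 - d) * (1 - e) * (1 - f).
set p := f * (1 - e); set q := d * (1 - f); set r := e * (1 - d).
have p0 : 0 < p by rewrite mulr_gt0 ?subr_gt0.
have q0 : 0 < q by rewrite mulr_gt0 ?subr_gt0.
have r0 : 0 < r by rewrite mulr_gt0 ?subr_gt0.
have u0 : 0 < u by rewrite !mulr_gt0.
have v0 : 0 < v by rewrite !mulr_gt0 ?subr_gt0.
have xE : u + v = 1 - p - q - r by rewrite /u /v /p /q /r; ring.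
have den0 : 0 < (1 - p) * (1 - q) * (1 - r).
  by rewrite !mulr_gt0 // subr_gt0; lra.
rewrite mulrA ler_pdivrMr // mulrC ler_wpM2l ?sqr_ge0 //.
have x1 : (u + v) ^+ 2 <= u + v.
  by rewrite expr2 ler_piMl ?addr_ge0 ?ltW // xE; lra.
apply: (le_trans x1); rewrite xE.
(* [(1-p)(1-q)(1-r)] expands to [(1-p-q-r) + pq(1-r) + r(p+q)], and both extra terms are
   nonnegative. *)
have pq : 0 <= p * q by rewrite mulr_ge0 ?ltW.
have pqr : 0 <= p * q * (1 - r) by rewrite mulr_ge0 //; lra.
have r' : 0 <= r * (p + q) by rewrite mulr_ge0 ?addr_ge0 ?ltW.
lra.
Qed.

Theorem theorem2p4 (R : realType) (A B C D E F G1 G2 G3 : 'rV[R]_2)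
    (p q r x y : R)
    (hABC : ~ collinear A B C)
    (hD : segment B C D) (hE : segment A C E) (hF : segment A B F)
    (hDv : D \notin [:: A; B; C])
    (hEv : E \notin [:: A; B; C])
    (hFv : F \notin [:: A; B; C])
    (hG1 : line B E `&` line C F = [set G1])
    (hG2 : line A D `&` line C F = [set G2])
    (hG3 : line A D `&` line B E = [set G3])
    (hp : p = triangle_area A E F)
    (hq : q = triangle_area B F D)
    (hr : r = triangle_area C D E)
    (hx : x = triangle_area D E F)
    (hy : y = triangle_area G1 G2 G3) :
  x ^+ 3 + (p + q + r) * x ^+ 2 - 4 * p * q * r >= x ^+ 2 * y.
Proof.
have {hDv} : [/\ D != B & D != C].
  by move: hDv; rewrite !inE !negb_or => /and3P[].
have {hEv} : [/\ E != A & E != C].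
  by move: hEv; rewrite !inE !negb_or => /and3P[].
have {hFv} : [/\ F != A & F != B].
  by move: hFv; rewrite !inE !negb_or => /and3P[].
move=> [nFA nFB] [nEA nEC] [nDB nDC].
have [d [d0 d1 _ eD]] := segment_ratio hD nDB nDC.
have [e' [e'0 e'1 _ eE']] := segment_ratio hE nEA nEC.
have [f [f0 f1 neqAB eF]] := segment_ratio hF nFA nFB.
(* [E] is reparametrised from [C] to [A], so that the three ratios run cyclically round the
   triangle. *)
have [e [e0 e1 eE]] : exists e : R, [/\ 0 < e, e < 1 & E = (1 - e) *: C + e *: A].
  by exists (1 - e'); split; [lra|lra|rewrite eE' subKr addrC].
have K0 : orient A B C != 0.
  by apply/eqP => /(orient_eq0_collinear neqAB).
have T0 : 0 <= triangle_area A B C by rewrite divr_ge0.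
have d01 : 0 < d < 1 by rewrite d0.
have e01 : 0 < e < 1 by rewrite e0.
have f01 : 0 < f < 1 by rewrite f0.
have {}hG1 : (line B E `&` line C F) G1 by rewrite hG1.
have {}hG2 : (line A D `&` line C F) G2 by rewrite hG2.
have {}hG3 : (line A D `&` line B E) G3 by rewrite hG3.
have hy' := routh_area K0 d01 e01 f01 eD eE eF hG1 hG2 hG3.
have [bA bB bC] : [/\ A = 1 *: A + 0 *: B + 0 *: C,
    B = 0 *: A + 1 *: B + 0 *: C & C = 0 *: A + 0 *: B + 1 *: C].
  by rewrite !scale0r !scale1r !addr0 !add0r.
have bD : D = 0 *: A + (1 - d) *: B + d *: C by rewrite scale0r add0r.
have bE : E = e *: A + 0 *: B + (1 - e) *: C.
  by rewrite scale0r addr0 addrC.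
have bF : F = (1 - f) *: A + f *: B + 0 *: C by rewrite scale0r addr0.
(* The corner triangles, with vertices in the stated order, are oriented opposite to [A B C]; hence
   the negative [k]. *)
have {}hp : p = f * (1 - e) * triangle_area A B C.
  rewrite hp (triangle_area_bary (k := - (f * (1 - e))) bA bE bF);
    try by ring.
  by rewrite normrN ger0_norm // mulr_ge0; lra.
have {}hq : q = d * (1 - f) * triangle_area A B C.
  rewrite hq (triangle_area_bary (k := - (d * (1 - f))) bB bF bD);
    try by ring.
  by rewrite normrN ger0_norm // mulr_ge0; lra.
have {}hr : r = e * (1 - d) * triangle_area A B C.
  rewrite hr (triangle_area_bary (k := - (e * (1 - d))) bC bD bE);
    try by ring.
  by rewrite normrN ger0_norm // mulr_ge0; lra.
have {}hx : x = (d * e * f + (1 - d) * (1 - e) * (1 - f))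
    * triangle_area A B C.
  set k := (X in X * _).
  rewrite hx (triangle_area_bary (k := k) bD bE bF) /k; try by ring.
  by rewrite ger0_norm // addr_ge0 // !mulr_ge0; lra.
have key := normalized_area_ineq d01 e01 f01.
rewrite hx hp hq hr hy hy'.
(* Both sides are now cubic in [T]. As [x + p + q + r = T] and [pqr = uv * T^3], the left side is
   [(u-v)^2 * T^3], so [key] times [T^3] suffices. Abstracting the quotient as [w] leaves only
   polynomial terms. *)
move: key T0; move: (triangle_area A B C) => T.
move: (_ / _) => w key T0.
have := ler_wpM2r (exprn_ge0 3 T0) key.
lra.
Qed.
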